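(* Let $X$ be a compact metric space and let $F:X\to 2^X$ be upper semi-continuous. Let $\overleftarrow{\mathrm{Orb}}(X,F)$ and $\mathrm{Orb}(X,F)$ be the spaces of backward orbits and of full orbits of $F$, each with the metric $\rho$. (1) If $\sigma:\overleftarrow{\mathrm{Orb}}(X,F)\to\overleftarrow{\mathrm{Orb}}(X,F)$ is the shift map defined by $\sigma(\ldots,x_{-2},x_{-1},x_0)=(\ldots,x_{-3},x_{-2},x_{-1})$, then $h(\sigma)=h(F)$. (2) If $\sigma:\mathrm{Orb}(X,F)\to\mathrm{Orb}(X,F)$ is the shift map defined by $\sigma(\mathbf{x})=\mathbf{y}$, where $y_i=x_{i+1}$ for each $i\in\mathbb{Z}$, then $h(\sigma)=h(F)$.
   Context: $\mathbb{N}=\{1,2,\ldots\}$. For a compact metric space $X$ with metric $d$, $2^X$ is the set of non-empty compact subsets of $X$. $F:X\to 2^X$ is upper semi-continuous if for every $x\in X$ and every open $V\subseteq X$ containing $F(x)$ there is an open $U\ni x$ with $F(t)\subseteq V$ for all $t\in U$. Orbits: for $n\in\mathbb{N}$, $\mathrm{Orb}_n(X,F)$ is the set of $n$-orbits, i.e. finite sequences $(x_0,\ldots,x_{n-1})$ in $X$ with $x_{i+1}\in F(x_i)$ for $0\le i\le n-2$, with the metric $D(\mathbf{x},\mathbf{y})=\max_{0\le i\le n-1}d(x_i,y_i)$. $\overleftarrow{\mathrm{Orb}}(X,F)$ is the set of backward orbits, i.e. sequences $(\ldots,x_{-2},x_{-1},x_0)$ in $X$ with $x_{i+1}\in F(x_i)$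 for all $i\le -1$. $\mathrm{Orb}(X,F)$ is the set of full orbits, i.e. sequences $(x_i)_{i\in\mathbb{Z}}$ in $X$ with $x_{i+1}\in F(x_i)$ for all $i\in\mathbb{Z}$. These two spaces carry the metric $\rho(\mathbf{x},\mathbf{y})=\sup_{i}\frac{d(x_i,y_i)}{|i|+1}$, where $i$ ranges over $\mathbb{Z}_{\le 0}$ and over $\mathbb{Z}$ respectively (inducing the subspace topology of the product topology). Entropy of a set-valued function: a subset of a metric space is $\epsilon$-separated if any two of its distinct points are at distance $\ge\epsilon$. For $n\in\mathbb{N}$, $\epsilon>0$, $s_{n,\epsilon}(F)$ is the largest cardinality of an $\epsilon$-separated subset of $(\mathrm{Orb}_n(X,F),D)$. The topological entropy of $F$ is $h(F)=\lim_{\epsilon\to0}\limsup_{n\to\infty}\frac1n\log s_{n,\epsilon}(F)\in[0,\infty]$. Entropy of a continuous single-valued map $f:Y\to Y$ on a compact metric space $(Y,d_Y)$: a set $S\subseteq Y$ is $(n,\epsilon)$-separated if $\max_{0\le i\le n-1}d_Y(f^i(x),f^i(y))\ge\epsilon$ for all distinct $x,y\in S$; $s_{n,\epsilon}(f)$ is the largest cardinality of such a set, and $h(f)=\lim_{\epsilon\to0}\limsup_{n\to\infty}\frac1n\log s_{n,\epsilon}(f)$. *)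

(* Defs.v *)
From HB Require Import structures.
From mathcomp Require Import all_boot all_order all_algebra.
From mathcomp Require Import all_classical all_reals all_analysis.

Set Implicit Arguments.
Unset Strict Implicit.
Unset Printing Implicit Defensive.

Import Order.TTheory GRing.Theory Num.Theory.
Import numFieldTopology.Exports.

Local Open Scope classical_set_scope.
Local Open Scope ring_scope.

Definition set_valued_usc {X : topologicalType} (F : X -> set X) : Prop :=
  forall (x : X) (V : set X), open V -> F x `<=` V ->
    exists U : set X, [/\ open U, U x & forall t, U t -> F t `<=` V].

Definition separated {R : realType} {T : Type} (d : T -> T -> R) (e : R)
    (S : set T) : Prop :=
  forall x y, S x -> S y -> x <> y -> e <= d x y.

(* The largest cardinality of an e-separated subset, as a supremum in \bar R;
   it is attained as soon as it is finite. *)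
Definition max_separated {R : realType} {T : choiceType} (d : T -> T -> R)
    (e : R) : \bar R :=
  ereal_sup [set counting S | S in [set S : set T | separated d e S]].

(* lim_(e -> 0) limsup_n (1/n) log (s n e).  The term n = 0 is irrelevant to
   the upper limit. *)
Definition entropy_rate {R : realType} (s : nat -> R -> \bar R) : \bar R :=
  lim ((limn_esup (fun n => (n%:R^-1)%:E * lne (s n e))%E) @[e --> 0^'+]).

(* In the next two maxima the neutral element 0 is harmless: distances are
   nonnegative and only n >= 1 matters. *)
Definition bowen_dist {R : realType} {Y : metricType R} (f : Y -> Y) (n : nat)
    (x y : Y) : R :=
  \big[Order.max/0]_(i < n) mdist (iter i f x) (iter i f y).

Definition map_entropy {R : realType} {Y : metricType R} (f : Y -> Y) : \bar R :=
  entropy_rate (fun n e => max_separated (bowen_dist f n) e).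

Definition max_dist {R : realType} {X : metricType R} (n : nat)
    (x y : 'I_n -> X) : R :=
  \big[Order.max/0]_(i < n) mdist (x i) (y i).

Record finite_orbit {R : realType} {X : metricType R} (F : X -> set X)
    (n : nat) := FiniteOrbit {
  finite_orbit_seq :> 'I_n -> X ;
  finite_orbit_step : forall i j : 'I_n, j = i.+1 :> nat ->
    F (finite_orbit_seq i) (finite_orbit_seq j) }.

(* rho, for an index set I in which i has absolute value w i. *)
Definition orbit_dist {R : realType} {X : metricType R} {I : Type}
    (w : I -> nat) (x y : I -> X) : R :=
  sup (range (fun i => mdist (x i) (y i) / ((w i)%:R + 1))).

(* Compactness of X is a parameter of the two spaces below because rho is only
   a metric when the distance of X is bounded. *)

(* (..., x_(-2), x_(-1), x_0) is encoded as k : nat |-> x_(-k). *)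
Record backward_orbit {R : realType} {X : metricType R}
    (cX : compact [set: X]) (F : X -> set X) := BackwardOrbit {
  backward_orbit_seq :> nat -> X ;
  backward_orbit_step :
    forall k, F (backward_orbit_seq k.+1) (backward_orbit_seq k) }.

Record full_orbit {R : realType} {X : metricType R}
    (cX : compact [set: X]) (F : X -> set X) := FullOrbit {
  full_orbit_seq :> int -> X ;
  full_orbit_step : forall i, F (full_orbit_seq i) (full_orbit_seq (i + 1)) }.

Lemma compact_mdist_bounded {R : realType} {X : metricType R} :
  compact [set: X] -> exists M : R, forall x y : X, mdist x y <= M.
Proof.
move=> cX; have [[p _]|X0] := pselect (exists p : X, True); last first.
  by exists 0 => x; exfalso; apply: X0; exists x.
have /compact_near_coveringP/(_ _ (pinfty_nbhs R) (fun M x => mdist p x <= M)) :=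
  cX.
move=> [x _|M [Mr MP]].
- exists (ball x 1, [set M | mdist p x + 1 <= M]) => /=.
    split; first exact: nbhsx_ballx.
    exact: nbhs_pinfty_ge (num_real _).
  move=> [y N] /= [xy pN]; rewrite (le_trans _ pN)//.
  rewrite (le_trans (metric_triangle _ x _))// lerD2l ltW//.
  by move: xy; rewrite ballEmdist.
- have {}MP x : mdist p x <= M + 1 by apply: MP => //; rewrite ltrDl.
  exists (M + 1 + (M + 1)) => x y.
  by rewrite (le_trans (metric_triangle _ p _))// lerD// metric_sym.
Qed.

Lemma finite_orbit_inj {R : realType} {X : metricType R} (F : X -> set X) n :
  injective (@finite_orbit_seq R X F n).
Proof.
case=> x hx [y hy] /= xy; case: _ / xy in hy *.
by congr FiniteOrbit; exact: Prop_irrelevance.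
Qed.

Lemma backward_orbit_inj {R : realType} {X : metricType R}
    (cX : compact [set: X]) (F : X -> set X) :
  injective (@backward_orbit_seq R X cX F).
Proof.
case=> x hx [y hy] /= xy; case: _ / xy in hy *.
by congr BackwardOrbit; exact: Prop_irrelevance.
Qed.

Lemma full_orbit_inj {R : realType} {X : metricType R}
    (cX : compact [set: X]) (F : X -> set X) :
  injective (@full_orbit_seq R X cX F).
Proof.
case=> x hx [y hy] /= xy; case: _ / xy in hy *.
by congr FullOrbit; exact: Prop_irrelevance.
Qed.

Lemma max_distxx {R : realType} {X : metricType R} n (x : 'I_n -> X) :
  max_dist x x = 0.
Proof.
rewrite /max_dist; elim/big_ind: _ => // [a b -> ->|i _]; first exact: maxxx.
exact: mdistxx.
Qed.

Lemma max_dist_ge {R : realType} {X : metricType R} n (x y : 'I_n -> X) i :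
  mdist (x i) (y i) <= max_dist x y.
Proof. by rewrite /max_dist; apply: le_bigmax. Qed.

Lemma max_dist_eq0 {R : realType} {X : metricType R} n (x y : 'I_n -> X) :
  max_dist x y = 0 -> x = y.
Proof.
move=> xy; apply/funext => i; apply: (@mdist_positivity R).
by apply/eqP; rewrite eq_le mdist_ge0 andbT -xy max_dist_ge.
Qed.

Lemma max_dist_sym {R : realType} {X : metricType R} n (x y : 'I_n -> X) :
  max_dist x y = max_dist y x.
Proof. by apply: eq_bigr => i _; rewrite metric_sym. Qed.

Lemma max_dist_triangle {R : realType} {X : metricType R} n
    (y x z : 'I_n -> X) :
  max_dist x z <= max_dist x y + max_dist y z.
Proof.
rewrite {1}/max_dist; apply/bigmax_leP; split=> [|i _].
  by rewrite addr_ge0// /max_dist; apply: bigmax_ge_id.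
by rewrite (le_trans (metric_triangle _ (y i) _))// lerD// max_dist_ge.
Qed.

Section OrbitDist.
Context {R : realType} {X : metricType R} (cX : compact [set: X]).
Context {I : Type} (i0 : I) (w : I -> nat).
Implicit Types x y z : I -> X.

Lemma orbit_dist_ge x y i :
  mdist (x i) (y i) / ((w i)%:R + 1) <= orbit_dist w x y.
Proof.
apply: ub_le_sup; last by exists i.
have [M hM] := compact_mdist_bounded cX.
exists M => _ [j _ <-]; rewrite (le_trans _ (hM (x j) (y j)))//.
by rewrite ler_pdivrMr ?ltr_wpDl// ler_peMr ?mdist_ge0// lerDr.
Qed.

Lemma orbit_dist_le x y (M : R) :
  (forall i, mdist (x i) (y i) / ((w i)%:R + 1) <= M) -> orbit_dist w x y <= M.
Proof.
move=> h; apply: ge_sup => [|_ [i _ <-]//].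
by exists (mdist (x i0) (y i0) / ((w i0)%:R + 1)), i0.
Qed.

Lemma orbit_distxx x : orbit_dist w x x = 0.
Proof.
apply/eqP; rewrite eq_le orbit_dist_le/= => [|i]; last by rewrite mdistxx mul0r.
by rewrite (le_trans _ (orbit_dist_ge x x i0))// mdistxx mul0r.
Qed.

Lemma orbit_dist_eq0 x y : orbit_dist w x y = 0 -> x = y.
Proof.
move=> xy; apply/funext => i; apply: (@mdist_positivity R).
apply/eqP; rewrite eq_le mdist_ge0 andbT.
have := orbit_dist_ge x y i.
by rewrite xy ler_pdivrMr ?ltr_wpDl// mul0r.
Qed.

Lemma orbit_dist_sym x y : orbit_dist w x y = orbit_dist w y x.
Proof.
by congr (sup _); apply: eq_imagel => i _; rewrite metric_sym.
Qed.

Lemma orbit_dist_triangle y x z :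
  orbit_dist w x z <= orbit_dist w x y + orbit_dist w y z.
Proof.
apply: orbit_dist_le => i.
rewrite (le_trans _ (lerD (orbit_dist_ge x y i) (orbit_dist_ge y z i)))//.
by rewrite -mulrDl ler_wpM2r ?invr_ge0 ?addr_ge0// metric_triangle.
Qed.

End OrbitDist.

HB.instance Definition _ {R : realType} {X : metricType R} (F : X -> set X) n :=
  gen_eqMixin (finite_orbit F n).
HB.instance Definition _ {R : realType} {X : metricType R} (F : X -> set X) n :=
  gen_choiceMixin (finite_orbit F n).
HB.instance Definition _ {R : realType} {X : metricType R} (F : X -> set X) n :=
  @isMetric.Build R (finite_orbit F n) (fun x y => max_dist x y)
    (fun x => max_distxx x)
    (fun x y xy => finite_orbit_inj (max_dist_eq0 xy))
    (fun x y => max_dist_sym x y)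
    (fun y x z => max_dist_triangle y x z).

HB.instance Definition _ {R : realType} {X : metricType R}
    (cX : compact [set: X]) (F : X -> set X) :=
  gen_eqMixin (backward_orbit cX F).
HB.instance Definition _ {R : realType} {X : metricType R}
    (cX : compact [set: X]) (F : X -> set X) :=
  gen_choiceMixin (backward_orbit cX F).
HB.instance Definition _ {R : realType} {X : metricType R}
    (cX : compact [set: X]) (F : X -> set X) :=
  @isMetric.Build R (backward_orbit cX F) (fun x y => orbit_dist id x y)
    (fun x => orbit_distxx cX 0%N id x)
    (fun x y xy => backward_orbit_inj (orbit_dist_eq0 cX xy))
    (fun x y => orbit_dist_sym id x y)
    (fun y x z => orbit_dist_triangle cX 0%N id y x z).

HB.instance Definition _ {R : realType} {X : metricType R}
    (cX : compact [set: X]) (F : X -> set X) :=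
  gen_eqMixin (full_orbit cX F).
HB.instance Definition _ {R : realType} {X : metricType R}
    (cX : compact [set: X]) (F : X -> set X) :=
  gen_choiceMixin (full_orbit cX F).
HB.instance Definition _ {R : realType} {X : metricType R}
    (cX : compact [set: X]) (F : X -> set X) :=
  @isMetric.Build R (full_orbit cX F) (fun x y => orbit_dist absz x y)
    (fun x => orbit_distxx cX 0 absz x)
    (fun x y xy => full_orbit_inj (orbit_dist_eq0 cX xy))
    (fun x y => orbit_dist_sym absz x y)
    (fun y x z => orbit_dist_triangle cX 0 absz y x z).

Definition set_valued_entropy {R : realType} {X : metricType R}
    (F : X -> set X) : \bar R :=
  entropy_rate (fun n e =>
    max_separated (@mdist R (finite_orbit F n)) e).

Definition backward_shift {R : realType} {X : metricType R}
    (cX : compact [set: X]) (F : X -> set X) (x : backward_orbit cX F) :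
    backward_orbit cX F :=
  BackwardOrbit cX (fun k => backward_orbit_step x k.+1).

Lemma full_shift_step {R : realType} {X : metricType R}
    (cX : compact [set: X]) (F : X -> set X) (x : full_orbit cX F) (i : int) :
  F (x (i + 1)) (x (i + 1 + 1)).
Proof. exact: full_orbit_step. Qed.

Definition full_shift {R : realType} {X : metricType R}
    (cX : compact [set: X]) (F : X -> set X) (x : full_orbit cX F) :
    full_orbit cX F :=
  @FullOrbit R X cX F (fun i => x (i + 1)) (full_shift_step x).

(* Main.v *)
Require Import Defs.
From HB Require Import structures.
From mathcomp Require Import all_boot all_order all_algebra finmap.
From mathcomp Require Import all_classical all_reals all_analysis.
From mathcomp Require Import ring lra zify.

(** Both shifts act on orbits that extend infinitely far into the past, whereas
    [set_valued_entropy F] counts all finite orbits, including those whose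
    first point has no preimage under [F].  The theorem says that the
    additional finite orbits do not contribute to the exponential growth.

    The shift entropies are at most that of [F]: since distances are bounded,
    two infinite orbits at [orbit_dist] at least [e] differ by at least [e / 2]
    at an index below some [N] depending only on [e] ([orbit_dist_ge_ex]).  An
    [(n, e)]-separated set of infinite orbits therefore restricts to an
    [e / 2]-separated set of [(n + N)]- or [(n + 2 N)]-orbits, and a bounded
    change of length does not increase the growth rate ([growth_rate_shift]).

    For the converse, fix [n] and [e], and let [s] be the largest number of
    [e]-separated segments of length [n] of infinite orbits.  By compactness
    there is an [m] such that, in every orbit of length [m + n], the last [n]
    points are [e]-close to a segment of an infinite orbit
    ([long_orbit_tail_near_backward]): a limit of longer and longer orbits,
    aligned at their ends, is a backward orbit, because the graph of an upper
    semi-continuous [F] is closed.  Now cut an orbit of length [N] into an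
    initial part of length between [m] and [m + n] and about [N / n] blocks of
    length [n].  Each block is preceded by at least [m] points, so one of [s]
    labels determines it up to a multiple of [e]; the initial part needs a
    number of labels independent of [N].  Hence at most [C * s ^ (N / n)]
    orbits of length [N] are separated ([max_separated_orbits_le]), and the
    growth rate for [F] is at most [ln s / n] ([growth_rate_orbits_le]).  This
    holds for every [n], which gives the inequality in the limit.

    [map_entropy_eq_set_valued_entropy] carries out both inequalities for an
    arbitrary map [f] with finite orbits attached to its points; the two shifts
    are instances, an infinite orbit being sent to the segment that the first
    [n] iterates of the shift read off. *)

Set Implicit Arguments.
Unset Strict Implicit.
Unset Printing Implicit Defensive.

Import Order.TTheory GRing.Theory Num.Theory.
Import numFieldTopology.Exports.

Local Open Scope classical_set_scope.
Local Open Scope ring_scope.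

(** * Cardinalities of separated sets *)

Section MaxSeparated.
Context {R : realType}.
Implicit Types (T : choiceType) (e : R).

Lemma fset_le_max_separated T (d : T -> T -> R) e (S : {fset T}) :
  Defs.separated d e [set` S] -> ((#|` S|%:R)%:E <= max_separated d e)%E.
Proof.
move=> sS; apply: ereal_sup_ubound; exists [set` S] => //.
by rewrite /counting asboolT ?set_fsetK//; exact: finite_fset.
Qed.

(** Finite sets suffice to bound the supremum: an infinite separated set has
    finite subsets, again separated, of every size. *)
Lemma max_separated_le T (d : T -> T -> R) e (y : \bar R) :
  (forall S : {fset T}, Defs.separated d e [set` S] -> ((#|` S|%:R)%:E <= y)%E) ->
  (max_separated d e <= y)%E.
Proof.
move=> Sy; apply: ge_ereal_sup => _ [S sS <-]; rewrite /counting.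
case: asboolP => [fS|/infinite_set_fset iS].
  by apply: Sy; rewrite fset_setK.
rewrite leye_eq; apply/eqP/eqyP => A A0.
have [B BS nB] := iS (Num.bound A).
apply: (@le_trans _ _ (#|` B|%:R)%:E); last by apply: Sy => x y' /BS Sx /BS; exact: sS.
rewrite lee_fin (le_trans (ltW (archi_boundP (ltW A0))))//.
by rewrite ler_nat.
Qed.

Lemma max_separated_ge0 T (d : T -> T -> R) e : (0 <= max_separated d e)%E.
Proof.
have := @fset_le_max_separated T d e fset0; rewrite cardfs0; apply.
by move=> x y /=; rewrite inE.
Qed.

(** The hypothesis makes [g] injective on [e]-separated sets and sends them to
    [e']-separated sets. *)
Lemma max_separated_le_map T T' (d : T -> T -> R) (d' : T' -> T' -> R) e e'
    (g : T -> T') :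
  0 < e' -> (forall u, d' u u = 0) ->
  (forall x y, e <= d x y -> e' <= d' (g x) (g y)) ->
  (max_separated d e <= max_separated d' e')%E.
Proof.
move=> e'0 d'0 gP; apply: max_separated_le => S sS.
have gI : {in S &, injective g}.
  move=> x y xS yS gxy; apply: contrapT => xy.
  by have := gP _ _ (sS _ _ xS yS xy); rewrite gxy d'0 leNgt e'0.
rewrite -(card_in_imfset imfset_key gI); apply: fset_le_max_separated.
move=> _ _ /imfsetP[x xS ->] /imfsetP[y yS ->] gxy.
by apply/gP/sS => // xy; apply: gxy; rewrite xy.
Qed.

Lemma max_separated_anti T (d : T -> T -> R) e e' :
  0 < e -> (forall x, d x x = 0) -> e <= e' ->
  (max_separated d e' <= max_separated d e)%E.
Proof.
move=> e0 d0 ee'; apply: (max_separated_le_map (g := id)) => // x y.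
exact: le_trans.
Qed.

(** Pigeonhole: a separated set has at most one point for each code. *)
Lemma max_separated_le_card T (K : finType) (d : T -> T -> R) e (c : T -> K) :
  (forall x y, c x = c y -> d x y < e) ->
  (max_separated d e <= (#|K|%:R)%:E)%E.
Proof.
move=> cP; apply: max_separated_le => S sS; rewrite lee_fin ler_nat.
have cI : {in S &, injective c}.
  move=> x y xS yS /cP dxy; apply: contrapT => xy.
  by have := sS _ _ xS yS xy; rewrite leNgt dxy.
rewrite -(card_in_imfset imfset_key cI) cardT.
by apply: uniq_leq_size => [|k _]; rewrite ?fset_uniq// mem_enum.
Qed.

(** A separated set of maximal size is a net, since a point far from all of its
    elements could be added to it. *)
Lemma separated_net T (d : T -> T -> R) e :
  0 < e -> (forall x, d x x = 0) -> (forall x y, d x y = d y x) ->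
  (max_separated d e < +oo)%E ->
  exists S : {fset T}, ((#|` S|%:R)%:E <= max_separated d e)%E /\
    forall x, exists y : S, d x (val y) < e.
Proof.
move=> e0 d0 dC sfin.
pose P k := `[< exists S : {fset T}, Defs.separated d e [set` S] /\ #|` S| = k >].
have Pex : exists k, P k.
  by exists 0; apply/asboolP; exists fset0; split => // x y /=; rewrite inE.
have [M HM] : exists M : nat, forall k, P k -> (k <= M)%N.
  have sfin' : max_separated d e \is a fin_num.
    by rewrite ge0_fin_numE ?max_separated_ge0.
  exists (Num.bound (fine (max_separated d e))) => k /asboolP[S [sS <-]].
  have := fset_le_max_separated sS; rewrite -(fineK sfin') lee_fin => kS.
  rewrite -(ler_nat R) (le_trans kS)// ltW// archi_boundP//.
  by rewrite fine_ge0// max_separated_ge0.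
have := ex_maxnP Pex HM => -[k /asboolP[S [sS Sk]] kmax].
exists S; split; first exact: fset_le_max_separated.
move=> x; apply: contrapT => /forallNP farx.
have far y : y \in S -> e <= d x y.
  by move=> yS; rewrite leNgt; apply/negP; exact: farx [` yS]%fset.
have xS : x \notin S by apply/negP => /far; rewrite d0 leNgt e0.
suff : P k.+1 by move=> /kmax; rewrite ltnn.
apply/asboolP; exists (x |` S)%fset; split; last by rewrite cardfsU1 xS Sk.
move=> a b /= /fset1UP[->|aS] /fset1UP[->|bS] ab; first by case: ab.
- exact: far.
- by rewrite dC; exact: far.
- exact: sS.
Qed.

End MaxSeparated.

(** * Exponential growth rates *)

Section UpperLimits.
Context {R : realType}.
Implicit Types (u v : (\bar R)^nat).
Local Open Scope ereal_scope.

Lemma limn_esup_le u (a : \bar R) n0 :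
  (forall n, (n0 <= n)%N -> u n <= a) -> limn_esup u <= a.
Proof.
move=> ua; apply: (@le_trans _ _ (ereal_sup (u @` [set n | (n0 <= n)%N]))).
  by apply: ereal_inf_lbound; exists [set n | (n0 <= n)%N] => //; exists n0.
by apply: ge_ereal_sup => _ [n /= n0n <-]; exact: ua.
Qed.

(** Additive constants in [ln (s n)] disappear in the rate [ln (s n) / n]. *)
Lemma limn_esup_le_perturb u (A c : R) n0 :
  (forall n, (n0 <= n)%N -> u n <= (A / n%:R + c)%:E) -> limn_esup u <= c%:E.
Proof.
move=> uA; apply/lee_addgt0Pr => e e0.
apply: (@limn_esup_le _ _ (maxn n0 (Num.bound (`|A| / e)%R).+1)) => n.
rewrite geq_max => /andP[/uA un nb]; rewrite (le_trans un)// -EFinD lee_fin.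
rewrite addrC lerD2l.
have n0' : (0 < n%:R :> R)%R by rewrite ltr0n (leq_trans _ nb).
rewrite ler_pdivrMr// mulrC -ler_pdivrMr//.
have : (`|A| / e < (Num.bound (`|A| / e))%:R)%R.
  by rewrite archi_boundP// divr_ge0// ltW.
move=> /ltW/le_trans h; apply: (@le_trans _ _ (`|A| / e)%R).
  by rewrite ler_pM2r ?invr_gt0// ler_norm.
by apply: h; rewrite ler_nat ltnW.
Qed.

Lemma limn_esup_ge u (a : \bar R) n0 :
  (forall n, (n0 <= n)%N -> a <= u n) -> a <= limn_esup u.
Proof.
move=> au; apply: le_ereal_inf_tmp => _ [V [N _ NV] <-].
apply: (@le_trans _ _ (u (maxn n0 N))); first by apply: au; rewrite leq_maxl.
apply: ereal_sup_ubound; exists (maxn n0 N) => //.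
by apply: NV; rewrite /= leq_maxr.
Qed.

Lemma limn_esup_lt u (a : \bar R) : limn_esup u < a ->
  exists n0, forall n, (n0 <= n)%N -> u n <= a.
Proof.
move=> /ereal_inf_lt[_ [V [N _ NV] <-]] supa; exists N => n Nn.
rewrite (le_trans _ (ltW supa))//; apply: ereal_sup_ubound; exists n => //.
exact: NV.
Qed.

Lemma le_limn_esup u v n0 : (forall n, (n0 <= n)%N -> u n <= v n) ->
  limn_esup u <= limn_esup v.
Proof.
move=> uv; apply: le_ereal_inf_tmp => _ [V [N _ NV] <-].
apply: (@limn_esup_le _ _ (maxn n0 N)) => n; rewrite geq_max => /andP[n0n Nn].
by rewrite (le_trans (uv _ n0n))//; apply: ereal_sup_ubound; exists n => //; exact: NV.
Qed.

Lemma le_lne (x y : \bar R) : 0 <= x -> x <= y -> lne x <= lne y.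
Proof.
by move=> x0 xy; rewrite lee_lne// in_itv/= leey ?x0// (le_trans x0).
Qed.

(** This is the upper limit inside [entropy_rate], at a fixed scale. *)
Definition growth_rate (s : nat -> \bar R) : \bar R :=
  limn_esup (fun n => (n%:R^-1)%:E * lne (s n)).

Lemma le_rate_term (s s' : \bar R) n : 0 <= s -> s <= s' ->
  (n%:R^-1 : R)%:E * lne s <= (n%:R^-1)%:E * lne s'.
Proof. by move=> s0 ss'; rewrite lee_wpmul2l ?lee_fin// le_lne. Qed.

Lemma lee_lt_fin (x y : \bar R) :
  (forall c : R, y < c%:E -> x <= c%:E) -> x <= y.
Proof.
case: y => [r| |] xc; last 1 first.
- case: x xc => [r /(_ (r - 1)%R (ltNyr _))|/(_ 0%R (ltNyr _))|]//.
  by rewrite lee_fin lerBrDl gerDr leNgt ltr01.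
- apply/lee_addgt0Pr => e e0; rewrite -EFinD; apply: xc.
  by rewrite lte_fin ltrDl.
- exact: leey.
Qed.

(** If [ln (s k) <= c * k] for all large [k], then
    [ln (s (N + n)) / n <= c + c * N / n], and the last term tends to 0. *)
Lemma growth_rate_shift (s : nat -> \bar R) N :
  growth_rate (fun n => s (N + n)%N) <= growth_rate s.
Proof.
apply: lee_lt_fin => c /limn_esup_lt[n0 sc].
apply: (@limn_esup_le_perturb _ (c * N%:R) c n0.+1) => n n0n.
have n_gt0 : (0 < n%:R :> R)%R by rewrite ltr0n (leq_trans _ n0n).
have Nn_gt0 : (0 < (N + n)%:R :> R)%R by rewrite natrD ltr_wpDl.
have := sc (N + n)%N (leq_trans (ltnW n0n) (leq_addl _ _)).
rewrite lee_pdivrMl// => /(lee_wpmul2l (x := (n%:R^-1)%:E)) h.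
apply: le_trans; first by apply: h; rewrite lee_fin invr_ge0 ltW.
rewrite -!EFinM lee_fin natrD le_eqVlt; apply/orP; left; apply/eqP.
by field; rewrite gt_eqF.
Qed.

(** The growth rate increases as the scale decreases, so its limit at 0 exists
    and is the supremum over all scales. *)
Lemma entropy_rate_sup (s : nat -> R -> \bar R) :
  (forall n e, 0 <= s n e) ->
  (forall n e e', (0 < e)%R -> (e <= e')%R -> s n e' <= s n e) ->
  entropy_rate s =
    ereal_sup ((fun e => growth_rate (s ^~ e)) @` [set e | (0 < e)%R]).
Proof.
move=> s0 sN; apply/cvg_lim => //.
have -> : [set e : R | (0 < e)%R] = [set` `]0%R, +oo[].
  by apply/seteqP; split => e /=; rewrite in_itv/= andbT.
apply: (nonincreasing_at_right_cvge (BInfty _ false)) => //.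
move=> e e' /[!in_itv]/= /[!andbT] e0 e'0 ee'.
by apply: (@le_limn_esup _ _ 0) => n _; apply: le_rate_term => //; exact: sN.
Qed.

(** Two entropies are compared by bounding the growth rate at each scale by the
    other growth rate at some scale, with no relation between the scales. *)
Lemma entropy_rate_le (s s' : nat -> R -> \bar R) :
  (forall n e, 0 <= s n e) ->
  (forall n e e', (0 < e)%R -> (e <= e')%R -> s n e' <= s n e) ->
  (forall n e, 0 <= s' n e) ->
  (forall n e e', (0 < e)%R -> (e <= e')%R -> s' n e' <= s' n e) ->
  (forall e, (0 < e)%R -> exists2 e', (0 < e')%R &
    growth_rate (s ^~ e) <= growth_rate (s' ^~ e')) ->
  entropy_rate s <= entropy_rate s'.
Proof.
move=> s0 sN s'0 s'N ss'; rewrite !entropy_rate_sup//.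
apply: ge_ereal_sup => _ [e /ss'[e' e'0 ee'] <-]; apply: le_trans ee' _.
by apply: ereal_sup_ubound; exists e'.
Qed.

End UpperLimits.

(** * Limits of orbits in a compact space *)

Section CompactMetric.
Context {R : realType} {X : metricType R} (cX : compact [set: X]).

(** Total boundedness: [c] sends a point to a nearby element of a finite
    [e / 2]-net. *)
Lemma compact_small_code (e : R) : 0 < e ->
  exists (K : finType) (c : X -> K), forall x y, c x = c y -> mdist x y < e.
Proof.
move=> e0; have e20 : 0 < e / 2 by rewrite divr_gt0.
(* Compactness is used as the near-covering property, for the filter of all
   sufficiently large finite sets: each point has a neighborhood on which every
   finite set containing that point is a net. *)
pose G := filter_from [set: {fset X}] (fun D => [set E : {fset X} | D `<=` E]%fset).
have GF : Filter G.
  apply: filter_from_filter; first by exists fset0.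
  by move=> A B _ _; exists (A `|` B)%fset => // E /=; rewrite fsubUset => /andP[].
pose P (E : {fset X}) x := exists y : E, mdist x (val y) < e / 2.
have [x _|D _ /(_ D (fsubset_refl _)) Dnet] :=
  (compact_near_coveringP _).1 cX _ G P GF.
  exists (ball x (e / 2), [set E | [fset x] `<=` E]%fset) => /=.
    by split; [exact: nbhsx_ballx|exists [fset x]%fset].
  move=> [y E] /= [xy xE]; have xE' : x \in E by rewrite -fsub1set.
  by exists [` xE']%fset => /=; rewrite metric_sym; move: xy; rewrite ballEmdist.
have /choice[c cP] : forall x, exists y : D, mdist x (val y) < e / 2.
  by move=> x; exact: Dnet.
exists D, c => x y cxy; rewrite (le_lt_trans (metric_triangle _ (val (c x)) _))//.
by rewrite (splitr e) ltrD// metric_sym cxy.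
Qed.

Lemma ultrafilter_cvg {I : Type} (U : set_system I) (z : I -> X) :
  UltraFilter U -> exists p : X, z @ U --> p.
Proof.
move=> UU; have [//|p [_ clp]] := cX (F := z @ U) _.
  exact: filterT.
exists p => V Vp; have [//|UnV] := in_ultra_setVsetC (z @^-1` V) UU.
by have [x [/= nVx Vx]] := clp (~` V) V UnV Vp.
Qed.

Variable F : X -> set X.
Hypothesis F_compact : forall x, compact (F x).
Hypothesis F_usc : set_valued_usc F.

(** If [q] is not in the closed set [F p], then [F p] lies in the open set of
    points at distance more than [r / 2] from [q] for some [r > 0].  By upper
    semi-continuity the same holds for [F (a i)] with [a i] close to [p], which
    is impossible when [b i] is within [r / 2] of [q]. *)
Lemma usc_closed_graph {I : Type} (U : set_system I) (a b : I -> X) p q :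
  ProperFilter U -> a @ U --> p -> b @ U --> q ->
  (\forall i \near U, F (a i) (b i)) -> F p q.
Proof.
move=> UP ap bq Fab; apply: contrapT => Fpq.
have clFp : closed (F p) by apply: compact_closed => //; exact: metric_hausdorff.
have /nbhs_ballP[r /= r0 rF] : nbhs q (~` F p).
  by apply: open_nbhs_nbhs; split => //; exact: closed_openC.
pose V := [set x | r / 2 < mdist q x].
have Vo : open V.
  rewrite openE => x Vx; apply/nbhs_ballP; exists (mdist q x - r / 2) => /=.
    by rewrite subr_gt0.
  move=> y; rewrite ballEmdist /V /= => xy.
  have := metric_triangle q y x; rewrite (metric_sym y); lra.
have FpV : F p `<=` V.
  move=> x Fx; rewrite /V /= ltNge; apply/negP => qx.
  have : ball q r x by rewrite ballEmdist /=; lra.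
  by move=> /rF.
have [W [Wo Wp WV]] := F_usc Vo FpV.
have Wa : \forall i \near U, W (a i) by apply: ap; exact: open_nbhs_nbhs.
have qb : \forall i \near U, ball q (r / 2) (b i).
  by apply: bq; apply: nbhsx_ballx; rewrite divr_gt0.
have [i [[Fi Wi] qi]] := filter_ex (filterI (filterI Fab Wa) qb).
have := WV _ Wi _ Fi; rewrite /V /=; move: qi; rewrite ballEmdist /=.
by move=> /ltW; rewrite leNgt => /negbTE ->.
Qed.

(** The index [n.-1 - i] appears because backward orbits are indexed by the
    time before the end: the end [u (m + n.-1)] is close to [y 0].  Were the
    statement false, there would be a counterexample [u m] for every [m]; these
    orbits, read backwards from their ends, have pointwise limits along an
    ultrafilter, which form a backward orbit close to the end of some [u m]. *)
Lemma long_orbit_tail_near_backward n (e : R) : 0 < e ->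
  exists m, forall u : nat -> X,
    (forall i, (i.+1 < m + n)%N -> F (u i) (u i.+1)) ->
    exists y : backward_orbit cX F,
      forall i, (i < n)%N -> mdist (u (m + i)%N) (y (n.-1 - i)%N) < e.
Proof.
move=> e0; apply: contrapT => /forallNP bad.
have {bad} /choice[u uP] : forall m, exists u : nat -> X,
    (forall i, (i.+1 < m + n)%N -> F (u i) (u i.+1)) /\
    forall y : backward_orbit cX F,
      ~ forall i, (i < n)%N -> mdist (u (m + i)%N) (y (n.-1 - i)%N) < e.
  move=> m; have /existsNP[u /not_implyP[Fu uN]] := bad m; exists u; split => //.
  by move=> y yP; apply: uN; exists y.
have [U [UU oU]] := @ultraFilterLemma nat \oo _.
(* [z k m] is the point [k] steps before the end of the orbit [u m]. *)
pose z k m := u m (m + n - k.+1)%N.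
have /choice[p zp] : forall k, exists p : X, z k @ U --> p.
  by move=> k; exact: ultrafilter_cvg.
have Fp k : F (p k.+1) (p k).
  apply: (usc_closed_graph _ (zp k.+1) (zp k)).
  apply: oU; exists k.+2 => // m /= km; rewrite /z.
  have [Fu _] := uP m; have := Fu (m + n - k.+2)%N.
  have -> : (m + n - k.+2).+1 = (m + n - k.+1)%N by lia.
  by apply; lia.
have near_p : \forall m \near U, forall i : 'I_n, ball (p (n.-1 - i)%N) e (z (n.-1 - i)%N m).
  by apply: filter_forall => i; apply: zp; exact: nbhsx_ballx.
have [m mP] := filter_ex near_p.
have [_ /(_ (BackwardOrbit cX Fp))] := uP m; apply => i ni /=.
have := mP (Ordinal ni); rewrite ballEmdist /= metric_sym /z.
by have -> : (m + n - (n.-1 - i).+1 = m + i)%N by lia.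
Qed.

End CompactMetric.

(** * Counting finite orbits *)

Section OrbitCounting.
Context {R : realType} {X : metricType R} (cX : compact [set: X]).
Variable F : X -> set X.

Lemma max_dist_lt n (x y : 'I_n -> X) (e : R) : 0 < e ->
  (forall i, mdist (x i) (y i) < e) -> max_dist x y < e.
Proof. by move=> e0 xy; apply/bigmax_ltP; split. Qed.

(** The family [w] plays the part of a finite net of the infinitely extendable
    orbits of length [n]: it shadows the end of every orbit of length [m + n]. *)
Lemma max_separated_orbits_le (n m : nat) (e : R) (S : finType)
    (w : S -> 'I_n -> X) : (0 < n)%N -> 0 < e ->
  (forall u : nat -> X, (forall i, (i.+1 < m + n)%N -> F (u i) (u i.+1)) ->
    exists s, forall i : 'I_n, mdist (u (m + i)%N) (w s i) < e) ->
  exists C : nat, forall N, (0 < N)%N ->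
    (max_separated (@mdist R (finite_orbit F N)) (e + e)
      <= ((C * #|S| ^ ((N - m) %/ n))%:R)%:E)%E.
Proof.
move=> n0 e0 tailS.
have ee0 : 0 < e + e by rewrite addr_gt0.
have [K [c cP]] := compact_small_code cX ee0.
(* The constant counts the codes of the initial part of the orbit. *)
exists (#|K| ^ (m + n))%N; case=> // N _.
(* [k] blocks of length [n] fit after the first [m] points; they are aligned
   to the end of the orbit, so that the initial part has length [p]. *)
set k := ((N.+1 - m) %/ n)%N; pose p := (N.+1 - k * n)%N.
have kn : (k * n <= N.+1 - m)%N by rewrite leq_divM.
have pmn : (p <= m + n)%N.
  by have := ltn_ceil (N.+1 - m) n0; rewrite -/k /p mulSn; lia.
(* Beyond the end of the orbit, which matters only when [N.+1 < m + n], [u x]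
   takes the default value [x ord0]; this merely refines the code below. *)
pose u (x : finite_orbit F N.+1) i := x (inord i).
have uF (x : finite_orbit F N.+1) i : (i.+1 < N.+1)%N -> F (u x i) (u x i.+1).
  by move=> iN; apply: finite_orbit_step; rewrite !inordK// ltnW.
(* The block [j], which starts at [p + j * n], is the end of the orbit of
   length [m + n] starting at [p + j * n - m]. *)
have /choice[g gP] : forall xj : finite_orbit F N.+1 * 'I_k, exists s,
    forall i : 'I_n, mdist (u xj.1 (p + xj.2 * n + i)%N) (w s i) < e.
  move=> [x j] /=.
  have jn : (j * n + n <= k * n)%N by rewrite addnC -mulSn leq_mul2r ltn_ord orbT.
  have [i im|s sP] := tailS (fun i => u x (p + j * n - m + i)%N).
    by rewrite addnS; apply: uF; rewrite /p; lia.
  exists s => i; have := sP i.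
  by rewrite addnA subnK// /p; lia.
pose code (x : finite_orbit F N.+1) : {ffun 'I_(m + n) -> K} * {ffun 'I_k -> S} :=
  ([ffun i : 'I_(m + n) => c (u x i)], [ffun j => g (x, j)]).
have -> : (#|K| ^ (m + n) * #|S| ^ k = #|{: {ffun 'I_(m + n) -> K} * {ffun 'I_k -> S}}|)%N.
  by rewrite card_prod !card_ffun !card_ord.
apply: (max_separated_le_card (c := code)) => x y [/ffunP cxy /ffunP gxy].
apply: max_dist_lt => // i.
have uE (z : finite_orbit F N.+1) : z i = u z i by rewrite /u inord_val.
rewrite !uE; have [ip|pi] := ltnP i p.
  by apply: cP; have := cxy (Ordinal (leq_trans ip pmn)); rewrite !ffunE.
have jk : ((i - p) %/ n < k)%N by rewrite ltn_divLR// /p; have := ltn_ord i; lia.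
pose j := Ordinal jk; pose r := Ordinal (ltn_pmod (i - p)%N n0).
have ij : (i = p + j * n + r :> nat)%N by rewrite -addnA -divn_eq subnKC.
have := gP (x, j) r; have := gP (y, j) r; have := gxy j; rewrite !ffunE /= => <-.
rewrite -ij => yw xw; rewrite (le_lt_trans (metric_triangle _ (w (g (x, j)) r) _))//.
by rewrite ltrD// metric_sym.
Qed.

(** Taking logarithms in [max_separated_orbits_le], with [(N - m) / n <= N / n].
    If [S] is empty then there are no orbits of length at least [m + n], and
    both sides are [-oo]. *)
Lemma growth_rate_orbits_le (n m : nat) (e : R) (S : finType)
    (w : S -> 'I_n -> X) : (0 < n)%N -> 0 < e ->
  (forall u : nat -> X, (forall i, (i.+1 < m + n)%N -> F (u i) (u i.+1)) ->
    exists s, forall i : 'I_n, mdist (u (m + i)%N) (w s i) < e) ->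
  (growth_rate (fun N => max_separated (@mdist R (finite_orbit F N)) (e + e))
    <= (n%:R^-1)%:E * lne (#|S|%:R)%:E)%E.
Proof.
move=> n0 e0 /(max_separated_orbits_le n0 e0)[C CP].
have [S0|S_gt0] := posnP #|S|.
  rewrite S0 [X in (_ <= _ * X)%E]le0_lneNy// gt0_muleNy ?lte_fin ?invr_gt0 ?ltr0n//.
  apply: (@limn_esup_le _ _ _ (m + n)) => N mnN.
  have N0 : (0 < N)%N by apply: leq_trans mnN; rewrite addn_gt0 n0 orbT.
  rewrite (@le0_lneNy _ (max_separated _ _)) ?gt0_muleNy ?lte_fin ?invr_gt0 ?ltr0n//.
  have := CP _ N0; rewrite S0 exp0n ?muln0//.
  by rewrite divn_gt0// leq_subRL// (leq_trans _ mnN)// leq_addr.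
rewrite lne_EFin ?ltr0n// -EFinM.
(* [C.+1] rather than [C], to stay in the domain of [ln]. *)
apply: (@limn_esup_le_perturb _ _ (ln (C.+1)%:R) _ 1) => N N0.
have N0' : 0 < N%:R :> R by rewrite ltr0n.
apply: (@le_trans _ _ ((N%:R^-1)%:E * lne ((C.+1 * #|S| ^ ((N - m) %/ n))%:R)%:E)%E).
  apply: le_rate_term; first exact: max_separated_ge0.
  by rewrite (le_trans (CP _ N0))// lee_fin ler_nat leq_mul2r leqnSn orbT.
rewrite natrM natrX lne_EFin; last by rewrite mulr_gt0 ?exprn_gt0 ?ltr0n.
rewrite lnM ?posrE ?exprn_gt0 ?ltr0n// lnXn ?ltr0n// -EFinM lee_fin.
rewrite mulrDr (mulrC _ (ln C.+1%:R)) lerD2l -(mulr_natl (ln _)) mulrA ler_wpM2r//.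
  by rewrite ln_ge0// ler1n.
rewrite ler_pdivrMl// ler_pdivlMr ?ltr0n// -natrM ler_nat.
by rewrite (leq_trans (leq_divM _ _))// leq_subr.
Qed.

End OrbitCounting.

(** * Comparison with the entropy of a map *)

Section Distances.
Context {R : realType}.

Lemma bowen_distxx (Y : metricType R) (f : Y -> Y) n (x : Y) :
  bowen_dist f n x x = 0.
Proof.
rewrite /bowen_dist; elim/big_ind: _ => // [a b -> ->|i _]; first exact: maxxx.
exact: mdistxx.
Qed.

Lemma bowen_dist_ge (Y : metricType R) (f : Y -> Y) n (i : 'I_n) (x y : Y) :
  mdist (iter i f x) (iter i f y) <= bowen_dist f n x y.
Proof. by rewrite /bowen_dist; apply: (le_bigmax _ (fun i : 'I_n => _)). Qed.

Lemma bowen_dist_ge_ex (Y : metricType R) (f : Y -> Y) n (x y : Y) (e : R) :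
  0 < e -> e <= bowen_dist f n x y ->
  exists2 i, (i < n)%N & e <= mdist (iter i f x) (iter i f y).
Proof.
move=> e0 exy; apply: contrapT => no; move: exy; rewrite leNgt => /negP; apply.
apply/bigmax_ltP; split => // i _; rewrite ltNge; apply/negP => ei.
by apply: no; exists i.
Qed.

(** The weights tend to 0 and distances are bounded, so only finitely many
    weights matter at scale [e].  The loss of a factor 2 is due to the
    supremum in [orbit_dist], which is only approached. *)
Lemma orbit_dist_ge_ex (X : metricType R) (cX : compact [set: X]) (I : Type)
    (i0 : I) (w : I -> nat) (e : R) : 0 < e ->
  exists N : nat, forall x y : I -> X, e <= orbit_dist w x y ->
    exists2 i, (w i < N)%N & e / 2 <= mdist (x i) (y i).
Proof.
move=> e0; have [M hM] := compact_mdist_bounded cX.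
exists (Num.bound (`|M| / (e / 2))) => x y exy; apply: contrapT => no.
have : orbit_dist w x y <= e / 2.
  apply: (orbit_dist_le i0) => i; rewrite ler_pdivrMr ?ltr_wpDl//.
  have [xy|xy] := ltP (mdist (x i) (y i)) (e / 2).
    by rewrite (le_trans (ltW xy))// ler_peMr ?lerDr// divr_ge0// ltW.
  rewrite (le_trans (hM _ _))// (le_trans (ler_norm _))//.
  have [wi|wi] := ltnP (w i) (Num.bound (`|M| / (e / 2))).
    by exfalso; apply: no; exists i.
  rewrite mulrC -ler_pdivrMr ?divr_gt0// (le_trans (ltW (archi_boundP _)))//.
    by rewrite divr_ge0// divr_ge0// ltW.
  by rewrite (le_trans (y := (w i)%:R)) ?ler_nat// lerDl.
lra.
Qed.

End Distances.

Section FactorEntropy.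
Context {R : realType} {X : metricType R} (cX : compact [set: X]).
Variable F : X -> set X.

(** Points of [Y] stand for infinite orbits and [orb n] for the part of an orbit
    seen by the first [n] iterates of [f].  The second hypothesis allows another
    segment [g] instead of a longer [orb], since the coordinates that matter
    for the distance in [Y] may lie on both sides of this part. *)
Lemma map_entropy_eq_set_valued_entropy (Y : metricType R) (f : Y -> Y)
    (orb : forall n, Y -> finite_orbit F n) :
  (forall n x y, max_dist (orb n x) (orb n y) <= bowen_dist f n x y) ->
  (forall e : R, 0 < e -> exists2 e' : R, 0 < e' & exists N, forall n,
    exists g : Y -> finite_orbit F (N + n), forall x y,
      e <= bowen_dist f n x y -> e' <= max_dist (g x) (g y)) ->
  (forall n (e : R), 0 < e -> exists m, forall u : nat -> X,
    (forall i, (i.+1 < m + n)%N -> F (u i) (u i.+1)) ->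
    exists y, forall i : 'I_n, mdist (u (m + i)%N) (orb n y i) < e) ->
  map_entropy f = set_valued_entropy F.
Proof.
move=> orb_le orb_ge orb_tail.
have s0 n e : (0 <= max_separated (bowen_dist f n) e)%E by exact: max_separated_ge0.
have s'0 n e : (0 <= max_separated (@mdist R (finite_orbit F n)) e)%E.
  exact: max_separated_ge0.
have sN n (e e' : R) : 0 < e -> e <= e' ->
    (max_separated (bowen_dist f n) e' <= max_separated (bowen_dist f n) e)%E.
  by move=> e0; apply: max_separated_anti => // x; exact: bowen_distxx.
have s'N n (e e' : R) : 0 < e -> e <= e' ->
    (max_separated (@mdist R (finite_orbit F n)) e' <=
     max_separated (@mdist R (finite_orbit F n)) e)%E.
  by move=> e0; apply: max_separated_anti => // x; exact: mdistxx.
apply/eqP; rewrite eq_le; apply/andP; split; apply: entropy_rate_le => // e e0.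
- have [e' e'0 [N gP]] := orb_ge e e0; exists e' => //.
  apply: le_trans (growth_rate_shift _ N).
  apply: (@le_limn_esup _ _ _ 0) => n _; apply: le_rate_term => //.
  have [g gn] := gP n; apply: (max_separated_le_map (g := g)) => // u.
  exact: mdistxx.
(* A quarter of [e]: a net element is within [e4] of a segment that is itself
   within [e4] of the block, and two blocks with the same label are compared
   through it. *)
- pose e4 := e / 2 / 2.
  have e40 : 0 < e4 by rewrite !divr_gt0.
  exists e4 => //; apply: (@limn_esup_ge _ _ _ 1) => n n0.
  pose d (x y : Y) := max_dist (orb n x) (orb n y).
  apply: (@le_trans _ _ ((n%:R^-1)%:E * lne (max_separated d e4))%E); last first.
    apply: le_rate_term; first exact: max_separated_ge0.
    apply: (max_separated_le_map (g := id)) => // [x|x y dxy].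
      exact: bowen_distxx.
    exact: le_trans dxy (orb_le _ _ _).
  have [sfin|] := ltP (max_separated d e4) +oo%E; last first.
    by rewrite leye_eq => /eqP ->; rewrite gt0_muley ?leey// lte_fin invr_gt0 ltr0n.
  have [S [cardS netS]] : exists S : {fset Y},
      ((#|` S|%:R)%:E <= max_separated d e4)%E /\
      forall x, exists y : S, d x (val y) < e4.
    apply: separated_net => // [x|x y]; first exact: max_distxx.
    exact: max_dist_sym.
  have [m mP] := orb_tail n e4 e40.
  apply: (@le_trans _ _ ((n%:R^-1)%:E * lne (#|{: S}|%:R)%:E)%E); last first.
    by apply: le_rate_term; rewrite ?lee_fin// -cardfE.
  have -> : e = e / 2 + e / 2 by rewrite -splitr.
  apply: (@growth_rate_orbits_le _ _ cX F n m (e / 2) S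
    (fun s => orb n (val s))) => //; first by rewrite divr_gt0.
  move=> u /mP[y uy]; have [s ys] := netS y; exists s => i.
  rewrite (splitr (e / 2)) (le_lt_trans (metric_triangle _ (orb n y i) _))//.
  by rewrite ltrD// (le_lt_trans _ ys)// max_dist_ge.
Qed.

End FactorEntropy.

(** * The two shifts *)

Section Shifts.
Context {R : realType} {X : metricType R} (cX : compact [set: X]).
Variable F : X -> set X.

Lemma iter_backward_shift i (x : backward_orbit cX F) k :
  iter i (@backward_shift R X cX F) x k = x (i + k)%N.
Proof. by elim: i k => [|i IH] k //=; rewrite IH addnS. Qed.

Lemma iter_full_shift i (x : full_orbit cX F) (k : int) :
  iter i (@full_shift R X cX F) x k = x (k + i%:Z).
Proof.
elim: i k => [|i IH] k /=; first by rewrite addr0.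
by rewrite IH; congr (x _); lia.
Qed.

Lemma backward_segment_step n (x : backward_orbit cX F) (i j : 'I_n) :
  j = i.+1 :> nat -> F (x (n.-1 - i)%N) (x (n.-1 - j)%N).
Proof.
move=> ji; have -> : (n.-1 - i = (n.-1 - j).+1)%N by have := ltn_ord j; lia.
exact: backward_orbit_step.
Qed.

(** The index is reversed because backward orbits are indexed against time. *)
Definition backward_segment n (x : backward_orbit cX F) : finite_orbit F n :=
  @FiniteOrbit R X F n (fun i : 'I_n => x (n.-1 - i)%N)
    (@backward_segment_step n x).

Lemma full_segment_step (a : int) n (x : full_orbit cX F) (i j : 'I_n) :
  j = i.+1 :> nat -> F (x (a + i%:Z)) (x (a + j%:Z)).
Proof.
move=> ->; have -> : a + i.+1%:Z = a + i%:Z + 1 by lia.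
exact: full_orbit_step.
Qed.

Definition full_segment (a : int) n (x : full_orbit cX F) : finite_orbit F n :=
  @FiniteOrbit R X F n (fun i : 'I_n => x (a + i%:Z)) (@full_segment_step a n x).

(** A choice of points in the values of [F] prolongs the orbit into the future;
    [a] is the time at which the backward orbit ends. *)
Lemma backward_orbit_extend (y : backward_orbit cX F) (a : int) :
  (forall x, F x !=set0) ->
  exists z : full_orbit cX F, forall k : nat, z (a - k%:Z) = y k.
Proof.
move=> /choice[g gF].
pose z (i : int) := if i is Posz k then iter k g (y 0%N) else y `|i|%N.
have zF i : F (z i) (z (i + 1)).
  case: i => [k|k]; first by rewrite -PoszD addn1 /=; exact: gF.
  case: k => [|k]; first exact: (backward_orbit_step y 0%N).
  have -> : Negz k.+1 + 1 = Negz k by rewrite !NegzE; lia.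
  exact: (backward_orbit_step y k.+1).
have zaF i : F (z (i - a)) (z (i + 1 - a)) by rewrite addrAC; exact: zF.
exists (@FullOrbit _ _ cX F (fun i => z (i - a)) zaF) => k /=.
by rewrite addrAC subrr sub0r; case: k.
Qed.

Hypothesis F_neq0 : forall x, F x !=set0.
Hypothesis F_compact : forall x, compact (F x).
Hypothesis F_usc : set_valued_usc F.

(** The [i]-th iterate of the shift drops [i] points from the end, so the
    first [n] iterates see the last [n] points; the weights below [N] reach
    [N] points further into the past. *)
Lemma backward_shift_entropy :
  map_entropy (@backward_shift R X cX F) = set_valued_entropy F.
Proof.
apply: (map_entropy_eq_set_valued_entropy cX (orb := backward_segment)).
- move=> n x y; apply/bigmax_leP; split => [|i _]; first exact: bigmax_ge_id.
  have := bowen_dist_ge (@backward_shift R X cX F) (rev_ord i) x y.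
  apply: le_trans; have := orbit_dist_ge cX id _ _ 0%N.
  move=> /(_ (iter (rev_ord i) (@backward_shift R X cX F) x)
             (iter (rev_ord i) (@backward_shift R X cX F) y)).
  rewrite /= add0r divr1 !iter_backward_shift addn0.
  by have -> : (n - i.+1 = n.-1 - i)%N by lia.
- move=> e e0; have [N NP] := orbit_dist_ge_ex cX 0%N id e0.
  exists (e / 2); first by rewrite divr_gt0.
  exists N => n; exists (backward_segment (N + n)) => x y.
  move=> /(bowen_dist_ge_ex e0)[i ni /NP[k /= kN]].
  rewrite !iter_backward_shift => /le_trans; apply.
  have jP : ((N + n).-1 - (i + k) < N + n)%N by lia.
  have := max_dist_ge (backward_segment (N + n) x) (backward_segment (N + n) y) (Ordinal jP).
  by rewrite /= subKn//; lia.
- move=> n e e0.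
  have [m mP] := long_orbit_tail_near_backward cX F_compact F_usc n e0.
  by exists m => u /mP[y yP]; exists y => i; exact: yP.
Qed.

(** The first [n] iterates see the coordinates from 0 to [n - 1]; the weights
    below [N] reach [N] coordinates further on each side. *)
Lemma full_shift_entropy :
  map_entropy (@full_shift R X cX F) = set_valued_entropy F.
Proof.
apply: (map_entropy_eq_set_valued_entropy cX (orb := full_segment 0)).
- move=> n x y; apply/bigmax_leP; split => [|i _]; first exact: bigmax_ge_id.
  have := bowen_dist_ge (@full_shift R X cX F) i x y.
  apply: le_trans; have := orbit_dist_ge cX absz _ _ 0.
  move=> /(_ (iter i (@full_shift R X cX F) x)
             (iter i (@full_shift R X cX F) y)).
  by rewrite /= add0r divr1 !iter_full_shift.
- move=> e e0; have [N NP] := orbit_dist_ge_ex cX (0 : int) absz e0.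
  exists (e / 2); first by rewrite divr_gt0.
  exists (N + N)%N => n; exists (full_segment (- N%:Z) (N + N + n)) => x y.
  move=> /(bowen_dist_ge_ex e0)[i ni /NP[k /= kN]].
  rewrite !iter_full_shift => /le_trans; apply.
  have jP : (absz (N%:Z + k + i%:Z)%R < N + N + n)%N by lia.
  have := max_dist_ge (full_segment (- N%:Z) (N + N + n) x)
    (full_segment (- N%:Z) (N + N + n) y) (Ordinal jP).
  by rewrite /=; have -> : - N%:Z + absz (N%:Z + k + i%:Z) = k + i%:Z by lia.
- move=> n e e0.
  have [m mP] := long_orbit_tail_near_backward cX F_compact F_usc n e0.
  exists m => u /mP[y yP]; have [z zP] := backward_orbit_extend y n.-1%:Z F_neq0.
  exists z => i; have := yP i (ltn_ord i); rewrite -zP /= add0r.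
  by have -> : n.-1%:Z - (n.-1 - i)%N%:Z = i%:Z by have := ltn_ord i; lia.
Qed.

End Shifts.

Theorem theorem3p5 (R : realType) (X : metricType R) (cX : compact [set: X])
    (F : X -> set X)
    (F_neq0 : forall x, F x !=set0)
    (F_compact : forall x, compact (F x))
    (F_usc : set_valued_usc F) :
  map_entropy (@backward_shift R X cX F) = set_valued_entropy F /\
  map_entropy (@full_shift R X cX F) = set_valued_entropy F.
Proof.
by split; [exact: backward_shift_entropy|exact: full_shift_entropy].
Qed.
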